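(* Consider an infinite horizon two-player zero-sum Markov game $(\mathcal S,\mathcal A,\mathcal B,\mathbb P,\sigma,\theta,\boldsymbol\rho_0)$ with $\mathcal S=\{s_1,\dots,s_{|\mathcal S|}\}$, and let $\mathcal X=\prod_{i=1}^{|\mathcal S|}\Delta_{\mathcal A}$, $\mathcal Y=\prod_{i=1}^{|\mathcal S|}\Delta_{\mathcal B}$, $\mathcal Z_i=\Delta_{\mathcal A}\times\Delta_{\mathcal B}$, $\mathcal Z=\mathcal X\times\mathcal Y$, $J^{\boldsymbol x,\boldsymbol y}(\boldsymbol\rho_0)=\mathbb E_{s_0\sim\boldsymbol\rho_0}[V^{\boldsymbol x,\boldsymbol y}(s_0)]$. For $\boldsymbol Q=(\boldsymbol Q_1,\dots,\boldsymbol Q_{|\mathcal S|})$ with $\boldsymbol Q_i\in\mathbb R^{|\mathcal A|\times|\mathcal B|}$ define $f_i(\boldsymbol Q,\boldsymbol z_i)=\boldsymbol x_i^\top\boldsymbol Q_i\boldsymbol y_i$ for $\boldsymbol z_i=(\boldsymbol x_i,\boldsymbol y_i)\in\mathcal Z_i$, with operator $\boldsymbol F_i(\boldsymbol Q,\boldsymbol z_i)=(\boldsymbol F_i^{\boldsymbol x},\boldsymbol F_i^{\boldsymbol y})=(\boldsymbol Q_i\boldsymbol y_i,-\boldsymbol Q_i^\top\boldsymbol x_i)$. Then there exist a tensor-valued function $\mathbf P:\mathbb R^{|\mathcal S|\times|\mathcal A|\times|\mathcal B|}\times\mathcal Z\to\mathbb R^{|\mathcal S|\times|\mathcal A|\times|\mathcal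 B|}$, a tensor $\boldsymbol Q^*$ and $(\boldsymbol x^*,\boldsymbol y^* )\in\mathcal Z$ such that: (i) $\boldsymbol Q^*=\mathbf P(\boldsymbol Q^*,\boldsymbol x^*,\boldsymbol y^* )$, and entrywise $\boldsymbol Q^*\le\mathbf P(\boldsymbol Q^*,\boldsymbol x,\boldsymbol y^* )$ and $\boldsymbol Q^*\ge\mathbf P(\boldsymbol Q^*,\boldsymbol x^*,\boldsymbol y)$ for all $\boldsymbol x\in\mathcal X,\boldsymbol y\in\mathcal Y$; (ii) for every $\boldsymbol\rho_0\in\Delta_{\mathcal S}$, $J^{\boldsymbol z}(\boldsymbol\rho_0)$ satisfies the generalized quasar-convexity-concavity condition with $f_i(\boldsymbol Q^*,\cdot)$: there are functions $\psi_i:\mathcal Z\to[0,\infty)$ such that for all $\boldsymbol z=(\boldsymbol x,\boldsymbol y)\in\mathcal Z$, $\mathcal G_{J(\boldsymbol\rho_0)}(\boldsymbol x,\boldsymbol y)\le\sum_{i=1}^{|\mathcal S|}\psi_i(\boldsymbol z)\,\mathcal G_{f_i(\boldsymbol Q^*,\cdot,\cdot)}(\boldsymbol x_i,\boldsymbol y_i)$; (iii) for some constant $C>0$, on the region $\{\|\boldsymbol Q\|_\infty\le C\}\times\mathcal Z$: (A1) there are $L_1,L_2\ge0$ with $\|\boldsymbol F_i(\boldsymbol Q,\boldsymbol z_i)-\boldsymbol F_i(\boldsymbol Q',\boldsymbol z_i)\|_\infty\le L_1\|\boldsymbol Q-\boldsymbol Q'\|_\infty$ and $\|\boldsymbol F_i(\boldsymbol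 Q,\boldsymbol z_i)-\boldsymbol F_i(\boldsymbol Q,\boldsymbol z_i')\|_\infty\le L_2\|\boldsymbol z_i-\boldsymbol z_i'\|_1$ for all $i$; (A2) there are $\gamma>0$ and entrywise non-negative constant tensors $\mathbf B_i,\mathbf C_i$ with $\|\sum_i(\mathbf B_i+\mathbf C_i)\|_\infty\le\gamma$ such that, entrywise, for all $\boldsymbol x,\boldsymbol x'\in\mathcal X$ and $\boldsymbol y,\boldsymbol y'\in\mathcal Y$, $\mathbf P(\boldsymbol Q,\boldsymbol x,\boldsymbol y)-\mathbf P(\boldsymbol Q,\boldsymbol x',\boldsymbol y)\le\sum_i\mathbf C_i\langle\boldsymbol F_i^{\boldsymbol x}(\boldsymbol Q,\boldsymbol z_i),\boldsymbol x_i-\boldsymbol x_i'\rangle$ and $\mathbf P(\boldsymbol Q,\boldsymbol x,\boldsymbol y)-\mathbf P(\boldsymbol Q,\boldsymbol x,\boldsymbol y')\ge\sum_i\mathbf B_i\langle\boldsymbol F_i^{\boldsymbol y}(\boldsymbol Q,\boldsymbol z_i),\boldsymbol y_i'-\boldsymbol y_i\rangle$; (A3) there is $\theta'\in[0,1)$ such that $\|\mathbf P(\boldsymbol Q,\boldsymbol z)-\mathbf P(\boldsymbol Q',\boldsymbol z)\|_\infty\le\theta'\|\boldsymbol Q-\boldsymbol Q'\|_\infty$, and $\|\mathbf P(\boldsymbol Q,\boldsymbol z)\|_\infty\le C$.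
   Context: Markov game: $\mathcal S,\mathcal A,\mathcal B$ are finite; $\mathbb P(s|s',a',b')$ is the probability of moving from $s'$ to $s$ when player 1 plays $a'$ and player 2 plays $b'$; $\sigma:\mathcal S\times\mathcal A\times\mathcal B\to[0,1]$ is the cost; $\theta\in[0,1)$ is the discount factor; $\boldsymbol\rho_0$ is an initial distribution on $\mathcal S$. For a joint policy $\boldsymbol z=(\boldsymbol x,\boldsymbol y)$, with $\boldsymbol x_i=\boldsymbol x(\cdot|s_i)$ and $\boldsymbol y_i=\boldsymbol y(\cdot|s_i)$, $V^{\boldsymbol z}(s)=(1-\theta)\mathbb E[\sum_{t\ge0}\theta^t\sigma(s_t,a_t,b_t)\mid s_0=s]$ where $a_t\sim\boldsymbol x(\cdot|s_t)$, $b_t\sim\boldsymbol y(\cdot|s_t)$ independently and $s_{t+1}\sim\mathbb P(\cdot|s_t,a_t,b_t)$. Player 1 minimizes and player 2 maximizes $J$. $\Delta_{\mathcal A},\Delta_{\mathcal B},\Delta_{\mathcal S}$ are probability simplexes. For tensors, $\|\cdot\|_\infty$ is the maximum absolute entry and inequalities are entrywise. The max-min gap of $h$ on $\mathcal U\times\mathcal W$ is $\mathcal G_h(\boldsymbol x,\boldsymbol y)=\max_{\boldsymbol y'\in\mathcal W}h(\boldsymbol x,\boldsymbol y')-\min_{\boldsymbol x'\in\mathcal U}h(\boldsymbol x',\boldsymbol y)$; $\mathcal G_{J(\boldsymbol\rho_0)}$ is this gap for $(\boldsymbol x,\boldsymbol y)\mapsto J^{\boldsymbol x,\boldsymbol y}(\boldsymbol\rho_0)$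 on $\mathcal X\times\mathcal Y$, and $\mathcal G_{f_i(\boldsymbol Q^*,\cdot,\cdot)}$ is taken on $\Delta_{\mathcal A}\times\Delta_{\mathcal B}$. *)

(* Defs.v *)
From HB Require Import structures.
From mathcomp Require Import all_boot all_order all_algebra.
From mathcomp Require Import all_classical all_reals all_analysis.
From mathcomp Require Import measurable_realfun ring.
Set Implicit Arguments.
Unset Strict Implicit.
Unset Printing Implicit Defensive.
Import Order.TTheory GRing.Theory Num.Theory.
Import numFieldNormedType.Exports.
Local Open Scope classical_set_scope.
Local Open Scope ring_scope.

Lemma rev_mkseqS (T : Type) (w : nat -> T) n :
  rev (mkseq w n.+1) = w n :: rev (mkseq w n).
Proof. by rewrite mkseqS rev_rcons. Qed.

(* Any consistent family of probabilities on finite words over a finite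
   alphabet is the law of the prefixes of some random sequence of letters
   driven by one uniform variable on [0, 1].  Words are written last letter
   first; the word w is given the interval [left w, left w + p w[. *)
Section random_sequence.
Context {R : realType} {E : finType}.
Context (p : seq E -> R) (p_ge0 : forall w, 0 <= p w) (p_nil : p [::] = 1)
  (p_cons : forall w, p w = \sum_e p (e :: w)) (e0 : E).

Let cum (w : seq E) (k : nat) : R :=
  \sum_(e | (enum_rank e < k)%N) p (e :: w).

Let cum0 w : cum w 0 = 0.
Proof. by rewrite /cum big_pred0. Qed.

Let cum_card w : cum w #|E| = p w.
Proof. by rewrite p_cons /cum; apply: eq_bigl => e; rewrite ltn_ord. Qed.

Let cumS w (e : E) : cum w (enum_rank e).+1 = cum w (enum_rank e) + p (e :: w).
Proof.
rewrite /cum (bigD1 e) //= addrC; congr (_ + _); apply: eq_bigl => e'.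
rewrite ltnS leq_eqVlt (inj_eq val_inj) (inj_eq enum_rank_inj).
by have [->|] := eqVneq e' e; rewrite ?ltnn ?andbT.
Qed.

Let cum_le w (k k' : nat) : (k <= k')%N -> cum w k <= cum w k'.
Proof.
move=> kk'; rewrite /cum [leRHS]big_mkcond [leLHS]big_mkcond /=.
apply: ler_sum => e _.
case: ifPn => [ek|_]; first by rewrite (leq_trans ek kk').
by case: ifP.
Qed.

Let left := fix left (w : seq E) : R :=
  if w is e :: w' then left w' + cum w' (enum_rank e) else 0.

Let cell (w : seq E) (u : R) : bool := left w <= u < left w + p w.

Let cell_sub e w u : cell (e :: w) u -> cell w u.
Proof.
rewrite /cell /= -addrA -cumS => /andP[lu ul]; apply/andP; split.
  apply: le_trans lu; rewrite lerDl -(cum0 w); exact: cum_le.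
apply: lt_le_trans ul _; rewrite lerD2l -cum_card; apply: cum_le.
exact: ltn_ord.
Qed.

Let cell_ex w u : cell w u -> exists e, cell (e :: w) u.
Proof.
move=> /andP[lu ul].
have ex : exists k, u < left w + cum w k by exists #|E|; rewrite cum_card.
have [[|k] uk kmin] := ex_minnP ex.
  by move: uk; rewrite cum0 addr0 ltNge lu.
have kE : (k < #|E|)%N.
  by apply: kmin; rewrite cum_card.
exists (enum_val (Ordinal kE)); rewrite /cell /= -addrA -cumS enum_valK /= uk.
rewrite andbT leNgt; apply/negP => uk0.
by have := kmin k uk0; rewrite ltnn.
Qed.

Let cell_inj w u e e' : cell (e :: w) u -> cell (e' :: w) u -> e = e'.
Proof.
rewrite /cell /= -!addrA -!cumS => /andP[l1 u1] /andP[l2 u2].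
apply: enum_rank_inj; apply: val_inj => /=.
case: (ltngtP (enum_rank e) (enum_rank e')) => // lt.
- have h := cum_le w lt; rewrite -(lerD2l (left w)) in h.
  by have := lt_le_trans u1 (le_trans h l2); rewrite ltxx.
- have h := cum_le w lt; rewrite -(lerD2l (left w)) in h.
  by have := lt_le_trans u2 (le_trans h l1); rewrite ltxx.
Qed.

Let cell_nil u : cell [::] u = (0 <= u < 1).
Proof. by rewrite /cell /= p_nil add0r. Qed.

Let word := fix word (n : nat) (u : R) : seq E :=
  if n is n'.+1 then
    let w := word n' u in odflt e0 [pick e | cell (e :: w) u] :: w
  else [::].

Let size_word n u : size (word n u) = n.
Proof. by elim: n => //= n ->. Qed.

Let cell_word n u : 0 <= u < 1 -> cell (word n u) u.
Proof.
move=> u01; elim: n => [|n IH] /=; first by rewrite cell_nil.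
case: pickP => [e //|none].
by have [e ce] := cell_ex IH; have := none e; rewrite ce.
Qed.

Let word_cell w u : 0 <= u < 1 -> cell w u -> word (size w) u = w.
Proof.
move=> u01; elim: w => //= e w IH cw; rewrite (IH (cell_sub cw)).
case: pickP => [e' ce'|none] /=; last by have := none e; rewrite cw.
by rewrite (cell_inj ce' cw).
Qed.

Let letter (n : nat) (u : R) : E :=
  head e0 (word n.+1 (if 0 <= u < 1 then u else 0)).

Let letterP (w : nat -> E) n u : 0 <= u < 1 ->
  (forall t, (t <= n)%N -> letter t u = w t) <->
  cell (rev (mkseq w n.+1)) u.
Proof.
move=> u01.
have wordS t : word t.+1 u = letter t u :: word t u.
  by rewrite /letter u01.
split=> [eqw|cw].
  have -> : rev (mkseq w n.+1) = word n.+1 u.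
    elim: n eqw => [|n IH] eqw.
      by rewrite wordS eqw.
    rewrite wordS eqw // -IH; last by move=> t tn; apply: eqw; exact: leqW.
    by rewrite rev_mkseqS.
  exact: cell_word.
have := word_cell u01 cw; rewrite size_rev size_mkseq.
elim: n {cw} => [|n IH] eqw t.
  by rewrite leqn0 => /eqP ->; move: eqw; rewrite wordS => -[].
move: eqw; rewrite wordS rev_mkseqS => -[eqn eqw]; rewrite leq_eqVlt => /predU1P[->//|].
by rewrite ltnS; exact: IH.
Qed.

Let cell_itv w : [set u | cell w u] = [set` `[left w, left w + p w[].
Proof. by apply/seteqP; split=> u /=; rewrite in_itv. Qed.

Let measurable_cell w : measurable [set u : R | cell w u].
Proof. by rewrite cell_itv; exact: measurable_itv. Qed.

Let cell01 w u : cell w u -> 0 <= u < 1.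
Proof. by elim: w => [|e w IH] => [|/cell_sub//]; rewrite cell_nil. Qed.

Let measurable_letter n (e : E) : measurable [set u | letter n u = e].
Proof.
have wordS t u : 0 <= u < 1 -> word t.+1 u = letter t u :: word t u.
  by move=> u01; rewrite /letter u01.
have -> : [set u | letter n u = e] =
    (\bigcup_(w : n.-tuple E) [set u | cell (e :: w) u]) `|`
    (if letter n 1 == e then ~` [set u | cell [::] u] else set0).
  apply/seteqP; split => u /=.
    move=> ue; case: (boolP (0 <= u < 1)) => u01; last first.
      right; suff -> : letter n 1 == e by rewrite /= cell_nil; exact/negP.
      by rewrite -ue /letter (negbTE u01) ltxx andbF.
    left; exists (Tuple (introT eqP (size_word n u))) => //=.
    by rewrite -ue -wordS //; exact: cell_word.
  move=> [[w _ /= cw]|].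
    have u01 := cell01 cw; have := word_cell u01 cw.
    by rewrite [size _]/= size_tuple wordS // => -[].
  case: eqP => // <- /=; rewrite cell_nil => /negP/negbTE u01.
  by rewrite /letter u01 ltxx andbF.
apply: measurableU.
  by apply: fin_bigcup_measurable => // w _; exact: measurable_cell.
by case: ifP => // _; apply: measurableC; exact: measurable_cell.
Qed.

Let letter_law (w : nat -> E) n :
  uniform_prob (@ltr01 R) [set u | forall t, (t <= n)%N -> letter t u = w t] =
  (p (rev (mkseq w n.+1)))%:E.
Proof.
set A := [set u | _].
have mA : measurable A.
  have -> : A = \bigcap_(t < n.+1) [set u | letter t u = w t].
    by apply/seteqP; split => u /= Au t; exact: Au.
  apply: fin_bigcap_measurable => [|t _]; last exact: measurable_letter.
  exact: finite_II.
rewrite -[A in LHS]setIT -integral_indic // integral_uniform //; last first.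
  by apply/measurable_EFinP/measurable_indic.
rewrite subr0 invr1 mul1e -integral_itv_bndo_bndc; last first.
  by apply/measurable_funTS/measurable_EFinP/measurable_indic.
rewrite integral_indic //.
have -> : A `&` `[0, 1[ = [set u | cell (rev (mkseq w n.+1)) u].
  apply/seteqP; split => u /=; rewrite in_itv /=.
    by move=> [Au u01]; apply/letterP.
  by move=> cu; have u01 := cell01 cu; split=> //; apply/(letterP w n u01).
rewrite cell_itv; apply: eq_trans (lebesgue_measure_itv _) _.
rewrite /= lte_fin ltrDl.
case: ltgtP (p_ge0 (rev (mkseq w n.+1))) => // [_|<-] _ //.
by rewrite -EFinD addrAC subrr add0r.
Qed.

Lemma random_sequence_exists : exists X : nat -> R -> E,
  (forall t e, measurable [set u | X t u = e]) /\
  (forall (w : nat -> E) n,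
    uniform_prob (@ltr01 R) [set u | forall t, (t <= n)%N -> X t u = w t] =
    (p (rev (mkseq w n.+1)))%:E).
Proof. by exists letter; split; [exact: measurable_letter|exact: letter_law]. Qed.

End random_sequence.

Record simplex (R : realType) (T : finType) := Simplex {
  pmf :> T -> R;
  pmf_ge0 : forall t, 0 <= pmf t;
  pmf_sum1 : \sum_t pmf t = 1 }.

(* [trans s' a' b' s] is the probability of moving from [s'] to [s]. *)
Record markov_game (R : realType) (S A B : finType) := MarkovGame {
  trans : S -> A -> B -> simplex R S;
  cost : S -> A -> B -> R;
  cost_itv : forall s a b, 0 <= cost s a b <= 1;
  discount : R;
  discount_itv : 0 <= discount < 1 }.

(* The product of |S| copies of the simplex over T: X for T = A, Y for T = B. *)
Definition policy (R : realType) (S T : finType) := S -> simplex R T.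

Section plays.
Context {R : realType} {S A B : finType}.
Implicit Types (G : markov_game R S A B) (x : policy R S A) (y : policy R S B).

(* The probability that the first n+1 (state, action, action) triples of a play
   started in s are w 0, ..., w n. *)
Definition play_prob G x y (s : S) (w : nat -> S * A * B) (n : nat) : R :=
  ((w 0%N).1.1 == s)%:R *
  (\prod_(t < n.+1) (x (w t).1.1 (w t).1.2 * y (w t).1.1 (w t).2)) *
  (\prod_(t < n) trans G (w t).1.1 (w t).1.2 (w t).2 (w t.+1).1.1).

(* Z is a play (s_t, a_t, b_t)_t of the game under (x, y) with s_0 = s, defined
   on the probability space (W, P). *)
Definition is_play G x y (s : S) d (W : measurableType d) (P : probability W R)
    (Z : nat -> W -> S * A * B) : Prop :=
  (forall t e, measurable [set u | Z t u = e]) /\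
  (forall (w : nat -> S * A * B) n,
    P [set u | forall t, (t <= n)%N -> Z t u = w t] = (play_prob G x y s w n)%:E).

Let word_prob G x y (s : S) := fix word_prob (w : seq (S * A * B)) : R :=
  if w is e :: w' then
    word_prob w' *
    (if w' is e' :: _ then trans G e'.1.1 e'.1.2 e'.2 e.1.1
     else (e.1.1 == s)%:R) * (x e.1.1 e.1.2 * y e.1.1 e.2)
  else 1.

Let word_prob_rev G x y s w n :
  word_prob G x y s (rev (mkseq w n.+1)) = play_prob G x y s w n.
Proof.
elim: n => [|n IH].
  rewrite rev_mkseqS /= /play_prob big_ord_recl !big_ord0; ring.
rewrite rev_mkseqS [LHS]/= IH rev_mkseqS /play_prob.
rewrite [in RHS]big_ord_recr [X in _ = _ * X]big_ord_recr /=; ring.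
Qed.

Let sum_step x y (c : S -> R) : \sum_s c s = 1 ->
  \sum_(e : S * A * B) c e.1.1 * (x e.1.1 e.1.2 * y e.1.1 e.2) = 1.
Proof.
move=> c1; rewrite -(pair_bigA _ (fun sa b => c sa.1 * (x sa.1 sa.2 * y sa.1 b))).
rewrite -(pair_bigA _ (fun s a => \sum_b c s * (x s a * y s b))) /= -c1.
apply: eq_bigr => s _.
under eq_bigr do rewrite -!mulr_sumr pmf_sum1 mulr1.
by rewrite -mulr_sumr pmf_sum1 mulr1.
Qed.

Lemma play_exists G x y (s : S) : exists Z : nat -> R -> S * A * B,
  is_play G x y s (uniform_prob (@ltr01 R)) Z.
Proof.
have simplex_gt0 (T : finType) (q : simplex R T) : exists t : T, true.
  apply: contrapT => noT; have := pmf_sum1 q; rewrite big1.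
    by move/eqP; rewrite eq_sym oner_eq0.
  by move=> t; case: noT; exists t.
have [a _] := simplex_gt0 _ (x s); have [b _] := simplex_gt0 _ (y s).
have [||e|Z [mZ lawZ]] := @random_sequence_exists R _ (word_prob G x y s) _ _ _ (s, a, b).
- elim=> [|e w IH] //=; rewrite !mulr_ge0 ?pmf_ge0 //.
  by case: w {IH} => *; rewrite ?ler0n ?pmf_ge0.
- by [].
- case: e => [|e w] /=.
    under [RHS]eq_bigr do rewrite mul1r.
    rewrite (sum_step x y (c := fun s' => (s' == s)%:R)) // (bigD1 s) //= eqxx big1 ?addr0 // => s' /negbTE ->.
    by [].
  under [RHS]eq_bigr do rewrite -mulrA.
  rewrite -mulr_sumr (sum_step x y (c := trans G e.1.1 e.1.2 e.2)) ?mulr1 //.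
  exact: pmf_sum1.
exists Z; split=> // w n; rewrite -word_prob_rev; exact: lawZ.
Qed.

(* The law of a play is determined by is_play, so the choice is immaterial. *)
Definition play G x y (s : S) : nat -> R -> S * A * B :=
  sval (cid (play_exists G x y s)).

Lemma playP G x y (s : S) :
  is_play G x y s (uniform_prob (@ltr01 R)) (play G x y s).
Proof. exact: svalP. Qed.

Definition value G x y (s : S) : R :=
  (1 - discount G) * fine 'E_(uniform_prob (@ltr01 R))[fun u =>
    limn (series (fun t => let: (st, a, b) := play G x y s t u in
                           discount G ^+ t * cost G st a b))].

Definition expected_value G x y (rho0 : simplex R S) : R :=
  \sum_s rho0 s * value G x y s.

End plays.

(* The maxima and minima of the gap are over compact sets in all uses below,
   hence equal to the supremum and infimum. *)
Definition gap (R : realType) (U W : Type) (h : U -> W -> R) (u : U) (w : W) : R :=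
  sup [set h u w' | w' in setT] - inf [set h u' w | u' in setT].

Definition quasar_convex_concave (R : realType) (S A B : finType)
    (J : policy R S A -> policy R S B -> R)
    (f : S -> simplex R A -> simplex R B -> R) : Prop :=
  exists psi : S -> policy R S A -> policy R S B -> R,
    (forall i x y, 0 <= psi i x y) /\
    (forall x y, gap J x y <= \sum_i psi i x y * gap (f i) (x i) (y i)).

Definition sup_norm (R : realType) (I : finType) (v : I -> R) : R :=
  \big[Num.max/0]_i `|v i|.

Definition l1_norm (R : realType) (I : finType) (v : I -> R) : R :=
  \sum_i `|v i|.

Definition tensor (R : realType) (S A B : finType) := S * A * B -> R.

Section bilinear.
Context {R : realType} {S A B : finType}.
Implicit Types (Q : tensor R S A B) (xi : simplex R A) (yi : simplex R B).

Definition bilin Q (i : S) xi yi : R :=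
  \sum_a \sum_b xi a * Q (i, a, b) * yi b.

Definition Fx Q (i : S) yi : A -> R := fun a => \sum_b Q (i, a, b) * yi b.

Definition Fy Q (i : S) xi : B -> R := fun b => - \sum_a Q (i, a, b) * xi a.

(* The sup norm of F_i(Q, (xi, yi)) - F_i(Q', (xi', yi')) in R^A x R^B. *)
Definition F_dist (i : S) Q xi yi Q' xi' yi' : R :=
  Num.max (sup_norm (Fx Q i yi \- Fx Q' i yi'))
          (sup_norm (Fy Q i xi \- Fy Q' i xi')).

End bilinear.

(* Main.v *)
Require Import Defs.
From mathcomp Require Import all_boot all_order all_algebra.
From mathcomp Require Import all_classical all_reals all_analysis.
From mathcomp Require Import ring lra measurable_realfun.
Set Implicit Arguments.
Unset Strict Implicit.
Unset Printing Implicit Defensive.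
Import Order.TTheory GRing.Theory Num.Theory.
Import numFieldNormedType.Exports.
Local Open Scope classical_set_scope.
Local Open Scope ring_scope.

(** Write [lookahead v] for the tensor of the payoffs of a play that stops after
one move and then pays [v] at the state reached,
  lookahead v (s, a, b) = (1 - theta) cost s a b + theta E[v s'],
and let P (Q, x, y) be the lookahead of the state function s |-> x_s^T Q_s y_s.
Up to a constant, P is a nonnegative combination, with weights theta * trans, of
the bilinear forms x_i^T Q_i y_i.  Hence the two bounds on its variation in x and
in y hold with equality, and P contracts by theta; it preserves the unit ball
because the costs lie in [0, 1].  So C = 1 suits.

The equilibrium conditions ask for a state function v such that v s is the
minimax value of the matrix game [lookahead v] at s (Shapley's equation): then
Q* = lookahead v, and x*, y* are optimal strategies in these matrix games.  The
map T that sends v to these minimax values is monotone, and the pointwise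
supremum of the functions v <= 1 with v <= T v is a fixed point of T by the
Knaster-Tarski argument ([shapley_equation]).  The minimax theorem itself
([minimax]) follows from a theorem of the alternative ([theorem_of_alternative]),
which is the first-order condition at a minimizer over the simplex of a smooth
penalty.

For the inequality between gaps, telescoping theta^t v (s_t) along a play under
(x, y) gives the performance difference identity
  value s - v s = sum_t theta^t E[(x^T Q* y - v) (s_t)]
([cvg_performance_difference]).  Under (x, y') each advantage x_i^T Q*_i y'_i - v i is
at most max_eta x_i^T Q*_i eta - v i, and under (x', y) it is at least
min_xi xi^T Q*_i y_i - v i; the difference of these two bounds is the gap of the
matrix game at i.  Bounding each advantage by the sum of the bounds over all states
gives the inequality with the constant weights psi_i = 1 / (1 - theta)
([gap_value_le]).  The identity involves only the laws of the single states s_t,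
which are extracted from the law of the play in [play_marginal]. *)

(** * The simplex and the minimax theorem *)

Section simplex.
Context {R : realType}.

Lemma dirac_pmf_ge0 (T : finType) (t0 t : T) : 0 <= (t == t0)%:R :> R.
Proof. exact: ler0n. Qed.

Lemma sum_dirac (T : finType) (t0 : T) (f : T -> R) :
  \sum_t (t == t0)%:R * f t = f t0.
Proof.
by rewrite (bigD1 t0)//= eqxx mul1r big1 ?addr0// => t /negbTE->; rewrite mul0r.
Qed.

Lemma dirac_pmf_sum1 (T : finType) (t0 : T) : \sum_t (t == t0)%:R = 1 :> R.
Proof. by rewrite -[RHS](sum_dirac t0 (fun=> 1)); under [RHS]eq_bigr do rewrite mulr1. Qed.

Definition dirac_simplex (T : finType) (t0 : T) : simplex R T :=
  Simplex (dirac_pmf_ge0 t0) (dirac_pmf_sum1 t0).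

Lemma mix_pmf_ge0 (T : finType) (p q : simplex R T) (e : R) :
  0 <= e <= 1 -> forall t, 0 <= (1 - e) * p t + e * q t.
Proof.
by move=> /andP[e0 e1] t; rewrite addr_ge0// mulr_ge0 ?Defs.pmf_ge0 ?subr_ge0.
Qed.

Lemma mix_pmf_sum1 (T : finType) (p q : simplex R T) (e : R) :
  \sum_t ((1 - e) * p t + e * q t) = 1.
Proof. by rewrite big_split/= -!mulr_sumr !pmf_sum1 !mulr1 subrK. Qed.

Definition mix (T : finType) (p q : simplex R T) (e : R) (e01 : 0 <= e <= 1) :=
  Simplex (mix_pmf_ge0 p q e01) (mix_pmf_sum1 p q e).

Lemma expect_le (T : finType) (p : simplex R T) (f : T -> R) (c : R) :
  (forall t, f t <= c) -> \sum_t p t * f t <= c.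
Proof.
move=> fc; rewrite -[leRHS]mul1r -(pmf_sum1 p) mulr_suml.
by apply: ler_sum => t _; rewrite ler_wpM2l ?Defs.pmf_ge0.
Qed.

Lemma expect_ge (T : finType) (p : simplex R T) (f : T -> R) (c : R) :
  (forall t, c <= f t) -> c <= \sum_t p t * f t.
Proof.
move=> fc; rewrite -[leLHS]mul1r -(pmf_sum1 p) mulr_suml.
by apply: ler_sum => t _; rewrite ler_wpM2l ?Defs.pmf_ge0.
Qed.

Lemma continuous_sum (X : topologicalType) (T : finType) (F : T -> X -> R) :
  (forall t, continuous (F t)) -> continuous (fun x => \sum_t F t x).
Proof.
move=> cF; apply: continuous_big => [|t _]; last exact: cF.
exact: add_continuous.
Qed.

Lemma continuousMr (X : topologicalType) (F : X -> R) (c : R) :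
  continuous F -> continuous (fun x => F x * c).
Proof. by move=> cF x; apply: cvgM; [exact: cF|exact: cvg_cst]. Qed.

Lemma continuous_sqr_excess (X : topologicalType) (F : X -> R) (c : R) :
  continuous F -> continuous (fun x => Num.max 0 (F x - c) ^+ 2).
Proof.
move=> cF x.
apply: (@continuous_comp _ _ _ (fun x => Num.max 0 (F x - c)) (fun t : R => t ^+ 2));
  last exact: exprn_continuous.
apply: (@continuous_max _ _ (fun=> 0) (fun x => F x - c)); first exact: cvg_cst.
by apply: cvgB; [exact: cF|exact: cvg_cst].
Qed.

Import ArrowAsProduct.

(** A closed subset of a cube, which is compact by Tychonoff. *)
Lemma simplex_compact (T : finType) :
  compact [set f : T -> R | (forall t, f t \in `[0, 1]) /\ \sum_t f t = 1].
Proof.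
have cube : compact [set f : T -> R | forall t, `[0, 1]%classic (f t)].
  by apply: (@tychonoff _ (fun=> R) (fun=> `[0, 1]%classic)) => _; exact: segment_compact.
apply: subclosed_compact cube _; last by move=> f [].
have cball : closed [set f : T -> R | forall t, `[0, 1]%classic (f t)].
  rewrite [X in closed X](_ : _ = \bigcap_t [set f : T -> R | `[0, 1]%classic (f t)]).
    apply: closed_bigI => t _.
    apply: (@preimage_closed _ _ (fun f : T -> R => f t)).
      by move=> f _; exact: (@proj_continuous _ (fun=> R) t).
    exact: itv_closed.
  by apply/seteqP; split => f /= h t; [move=> _|]; exact: h.
apply: closedI => //.
apply: (@preimage_closed _ _ (fun f : T -> R => \sum_t f t) [set 1]).
  move=> f _; apply: continuous_sum => t.
  exact: (@proj_continuous _ (fun=> R) t).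
exact: closed_eq.
Qed.

Lemma simplex_argmin (T : finType) (phi : (T -> R) -> R) :
  (0 < #|T|)%N -> continuous phi ->
  exists p : simplex R T, forall q : simplex R T, phi p <= phi q.
Proof.
move=> /card_gt0P[t0 _] cphi.
have mem (q : simplex R T) : (q : T -> R) \in
    [set f : T -> R | (forall t, f t \in `[0, 1]) /\ \sum_t f t = 1].
  rewrite inE/=; split; last exact: pmf_sum1.
  move=> t; rewrite in_itv/= Defs.pmf_ge0/= -(pmf_sum1 q) (bigD1 t)//= lerDl.
  by apply: sumr_ge0 => *; exact: Defs.pmf_ge0.
have [|f] := compact_EVT_min _ (@simplex_compact T) (continuous_subspaceT cphi).
  by exists (Defs.pmf (dirac_simplex t0)); exact: set_mem (mem _).
rewrite inE/= => -[f01 f1] fmin.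
have f0 t : 0 <= f t by have := f01 t; rewrite in_itv/= => /andP[].
by exists (Simplex f0 f1) => q; exact: fmin (mem q).
Qed.

Lemma continuous_expect (T : finType) (f : T -> R) :
  continuous (fun p : T -> R => \sum_t p t * f t).
Proof.
apply: continuous_sum => t; apply: continuousMr.
exact: (@proj_continuous _ (fun=> R) t).
Qed.

(** The positive part squared has derivative twice the positive part, up to a
quadratic error: this is all the smoothness that the penalty below needs. *)
Lemma sqr_maxD_le (u v : R) :
  Num.max 0 (u + v) ^+ 2 <= Num.max 0 u ^+ 2 + (Num.max 0 u * v) *+ 2 + v ^+ 2.
Proof.
have [u0|u0] := leP u 0; last first.
  have -> : u ^+ 2 + (u * v) *+ 2 + v ^+ 2 = (u + v) ^+ 2 by ring.
  have [_|_//] := leP (u + v) 0; by rewrite expr0n sqr_ge0.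
rewrite expr0n mul0r mul0rn !add0r.
have [_|uv0] := leP (u + v) 0; first by rewrite expr0n sqr_ge0.
by rewrite lerXn2r// ?nnegrE; lra.
Qed.

(** Let x minimize the sum over b of the squared excesses of the payoffs (x^T M)_b
over c.  If all excesses vanish, x is as in the first case.  Otherwise the weights
y proportional to the excesses are as in the second: moving x towards a vertex a
cannot decrease the penalty, and the derivative in that direction is a positive
multiple of (M y)_a - x^T M y, while x^T M y > c because y only charges the b with
(x^T M)_b > c.  That the second inequality is strict lets [minimax] reach the
exact value. *)
Lemma theorem_of_alternative (A B : finType) (M : A -> B -> R) (c : R) :
  (0 < #|A|)%N ->
  (exists x : simplex R A, forall b, \sum_a x a * M a b <= c) \/
  (exists y : simplex R B, forall a, c < \sum_b y b * M a b).
Proof.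
move=> A_gt0.
pose excess (x : A -> R) b := Num.max 0 (\sum_a x a * M a b - c).
have [|p pmin] := @simplex_argmin A (fun x => \sum_b excess x b ^+ 2) A_gt0.
  apply: continuous_sum => b; apply: continuous_sqr_excess.
  exact: continuous_expect.
pose w := excess p.
have w_ge0 b : 0 <= w b by rewrite le_max lexx.
have [w0|w_neq0] := eqVneq (\sum_b w b) 0.
  left; exists p => b.
  have /(_ b isT) wb0 := psumr_eq0P (fun i _ => w_ge0 i) w0.
  by rewrite -subr_le0 -[leRHS]wb0 /w /excess le_max lexx orbT.
right; have W_gt0 : 0 < \sum_b w b by rewrite lt_def w_neq0 sumr_ge0.
have [b0 wb0] : exists b0, 0 < w b0.
  have /existsP[b wb] : [exists b, w b != 0].
    apply: contraNT w_neq0; rewrite negb_exists => /forallP w0.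
    by rewrite big1// => b _; apply/eqP; have := w0 b; rewrite negbK.
  by exists b; rewrite lt_def wb w_ge0.
have y_ge0 b : 0 <= w b / \sum_b w b by rewrite divr_ge0// ltW.
have y_sum1 : \sum_b w b / \sum_b w b = 1 by rewrite -mulr_suml divff.
exists (Simplex y_ge0 y_sum1) => a /=.
under eq_bigr do rewrite mulrAC.
rewrite -mulr_suml ltr_pdivlMr//.
pose d b := M a b - \sum_a p a * M a b.
have deriv_ge0 : 0 <= \sum_b w b * d b.
  set L := \sum_b w b * d b; rewrite leNgt; apply/negP => L_lt0.
  pose D := \sum_b d b ^+ 2.
  have D_ge0 : 0 <= D by apply: sumr_ge0 => b _; exact: sqr_ge0.
  have DL : 0 < D - L by lra.
  (* D bounds the quadratic error; this step is at most 1 and small enough for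
     e ^+ 2 * D to stay below - 2 * e * L. *)
  have [e e_gt0 eDL] : exists2 e, 0 < e & e * (D - L) = - L.
    by exists (- L / (D - L)); [rewrite divr_gt0// oppr_gt0|rewrite divfK// gt_eqF].
  have e01 : 0 <= e <= 1 by rewrite ltW//= -(ler_pM2r DL) eDL mul1r; lra.
  have := pmin (mix p (dirac_simplex a) e01); rewrite leNgt => /negP; apply.
  apply: (@le_lt_trans _ _ (\sum_b (w b ^+ 2 + (w b * d b) *+ 2 * e + d b ^+ 2 * e ^+ 2))).
    apply: ler_sum => b _.
    have -> : excess (mix p (dirac_simplex a) e01) b =
        Num.max 0 (\sum_a p a * M a b - c + e * d b).
      rewrite /excess; congr Num.max; rewrite /=.
      under eq_bigr do rewrite mulrDl -!mulrA.
      rewrite big_split/= -!mulr_sumr sum_dirac /d; ring.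
    rewrite /w /excess; set u := _ - c.
    set v := e * d b.
    have -> : d b ^+ 2 * e ^+ 2 = v ^+ 2 by rewrite /v; ring.
    have -> : (Num.max 0 u * d b) *+ 2 * e = (Num.max 0 u * v) *+ 2 by rewrite /v; ring.
    exact: sqr_maxD_le.
  rewrite 2!big_split/= -!mulr_suml sumrMnl -/L -/D -addrA gtrDl.
  have -> : L *+ 2 * e + D * e ^+ 2 = e * (L + (L + D * e)) by ring.
  rewrite pmulr_rlt0//.
  have : e * L < 0 by rewrite pmulr_rlt0.
  by lra.
have -> : \sum_b w b * M a b = \sum_b w b * d b + \sum_b w b * (\sum_a p a * M a b).
  by rewrite -big_split; apply: eq_bigr => b _; rewrite /d/=; ring.
apply: ltr_wpDl => //; rewrite mulrC mulr_suml -subr_gt0 -sumrB (bigD1 b0)//=.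
have term b : w b * (\sum_a p a * M a b) - w b * c = w b ^+ 2.
  rewrite -mulrBr /w /excess; set u := _ - c.
  have [u0|u0] := leP u 0; first by rewrite !mul0r expr0n.
  by rewrite expr2.
rewrite term ltr_wpDr ?exprn_gt0//.
by apply: sumr_ge0 => b _; rewrite term sqr_ge0.
Qed.

Lemma finite_lt_gap (T : finType) (F : T -> R) (c : R) :
  (forall t, c < F t) -> exists2 c', c < c' & forall t, c' <= F t.
Proof.
move=> cF; exists (\big[Num.min/c + 1]_t F t).
  by apply: lt_bigmin => //; rewrite ltrDl.
by move=> t; exact: bigmin_le.
Qed.

(** The value is the supremum v of the payoffs that the column player can
guarantee.  The alternative at v cannot give a mixed column beating v strictly, as
it would guarantee some v' > v; applied to the game with the players exchanged, it
cannot give a mixed row that keeps the payoffs strictly below v, as it would keep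
them below some v' < v. *)
Theorem minimax (A B : finType) (M : A -> B -> R) :
  (0 < #|A|)%N -> (0 < #|B|)%N ->
  exists (x : simplex R A) (y : simplex R B) (v : R),
    (forall b, \sum_a x a * M a b <= v) /\ (forall a, v <= \sum_b y b * M a b).
Proof.
move=> A_gt0 B_gt0.
pose E := [set c | exists y : simplex R B, forall a, c <= \sum_b y b * M a b].
have weak (c v : R) (x : simplex R A) :
    E c -> (forall b, \sum_a x a * M a b <= v) -> c <= v.
  move=> [y cy] xv; apply: (le_trans (expect_ge x cy)).
  under eq_bigr do rewrite mulr_sumr.
  rewrite exchange_big; under eq_bigr do under eq_bigr do rewrite mulrCA.
  by under eq_bigr do rewrite -mulr_sumr; exact: expect_le.
have E0 : E !=set0.
  have /card_gt0P[b0 _] := B_gt0.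
  have [|c _ cM] := @finite_lt_gap A (M^~ b0) (- \sum_a `|M a b0| - 1).
    move=> a; rewrite ltrBlDr (@le_lt_trans _ _ (- `|M a b0|))//.
      by rewrite lerN2 (bigD1 a)//= lerDl sumr_ge0.
    by rewrite ltr_pwDr// lerNl ler_normr lexx orbT.
  exists c, (dirac_simplex b0) => a; by rewrite sum_dirac.
have /card_gt0P[a0 _] := A_gt0.
have Eub : has_ubound E.
  exists (\sum_b `|M a0 b|) => c Ec; apply: (weak _ _ (dirac_simplex a0) Ec) => b.
  by rewrite sum_dirac (le_trans (ler_norm _))// (bigD1 b)//= lerDl sumr_ge0.
have [[x xv]|[y /finite_lt_gap[c' lt_c' y_c']]] :=
  theorem_of_alternative M (sup E) A_gt0; last first.
  have : c' <= sup E by apply: ub_le_sup => //; exists y.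
  by rewrite leNgt lt_c'.
have [[y yv]|[x' /finite_lt_gap[c' lt_c' x_c']]] :=
  theorem_of_alternative (fun b a => - M a b) (- sup E) B_gt0; last first.
  have : sup E <= - c'.
    apply: ge_sup => // c Ec; apply: (weak c _ x' Ec) => b.
    by rewrite lerNr -sumrN; under eq_bigr do rewrite -mulrN.
  by rewrite lerNr leNgt lt_c'.
exists x, y, (sup E); split=> // a.
by rewrite -lerN2 -sumrN; under eq_bigr do rewrite -mulrN.
Qed.

End simplex.

(** * Saddle points of the stage games *)

Section matrix_game.
Context {R : realType} {S A B : finType}.
Implicit Types (Q : tensor R S A B) (i : S) (xi : simplex R A) (yi : simplex R B).

Lemma bilin_exp_col Q i xi yi :
  bilin Q i xi yi = \sum_b yi b * \sum_a xi a * Q (i, a, b).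
Proof.
rewrite /bilin exchange_big; apply: eq_bigr => b _.
by rewrite mulr_sumr; apply: eq_bigr => a _; rewrite mulrC.
Qed.

Lemma bilin_exp_row Q i xi yi :
  bilin Q i xi yi = \sum_a xi a * \sum_b yi b * Q (i, a, b).
Proof.
apply: eq_bigr => a _; rewrite mulr_sumr; apply: eq_bigr => b _.
by rewrite -mulrA [X in _ * X]mulrC.
Qed.

Definition saddle Q i (z : simplex R A * simplex R B) :=
  (forall xi, bilin Q i z.1 z.2 <= bilin Q i xi z.2) /\
  (forall yi, bilin Q i z.1 yi <= bilin Q i z.1 z.2).

Lemma saddle_exists (A_gt0 : (0 < #|A|)%N) (B_gt0 : (0 < #|B|)%N) Q i :
  exists z, saddle Q i z.
Proof.
have [x [y [v [xv vy]]]] := minimax (fun a b => Q (i, a, b)) A_gt0 B_gt0.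
exists (x, y).
have upper yi : bilin Q i x yi <= v by rewrite bilin_exp_col; exact: expect_le.
have lower xi : v <= bilin Q i xi y by rewrite bilin_exp_row; exact: expect_ge.
by split=> [xi|yi]; [exact: le_trans (upper _) (lower _)|
                     exact: le_trans (upper _) (lower _)].
Qed.

Lemma le_bilin Q Q' i xi yi : (forall a b, Q (i, a, b) <= Q' (i, a, b)) ->
  bilin Q i xi yi <= bilin Q' i xi yi.
Proof.
move=> QQ'; apply: ler_sum => a _; apply: ler_sum => b _.
by rewrite ler_wpM2r ?Defs.pmf_ge0// ler_wpM2l ?Defs.pmf_ge0.
Qed.

(** This monotonicity of the value of a matrix game in its payoffs makes Shapley's
operator monotone. *)
Lemma saddle_value_le Q Q' i z z' : saddle Q i z -> saddle Q' i z' ->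
  (forall a b, Q (i, a, b) <= Q' (i, a, b)) ->
  bilin Q i z.1 z.2 <= bilin Q' i z'.1 z'.2.
Proof.
move=> [zmin _] [_ z'max] QQ'; apply: le_trans (zmin z'.1) _.
exact: le_trans (le_bilin _ _ QQ') (z'max z.2).
Qed.

Lemma bilin_le Q i xi yi c : (forall a b, Q (i, a, b) <= c) -> bilin Q i xi yi <= c.
Proof. by move=> Qc; rewrite bilin_exp_col; apply: expect_le => b; exact: expect_le. Qed.

Lemma bilin_ge Q i xi yi c : (forall a b, c <= Q (i, a, b)) -> c <= bilin Q i xi yi.
Proof. by move=> Qc; rewrite bilin_exp_col; apply: expect_ge => b; exact: expect_ge. Qed.

End matrix_game.

(** * The law of the states along a play *)

Section fibers.
Context d (W : measurableType d) (R : realType) (P : probability W R).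
Context (E : finType) (X : W -> E).
Context (mX : forall e, measurable [set u | X u = e]).

Lemma measure_sum_fiber (D : set W) : measurable D ->
  P D = (\sum_e P (D `&` [set u | X u = e]))%E.
Proof.
move=> mD; pose F e := D `&` [set u | X u = e].
have -> : (\sum_e P (F e))%E = (\sum_(e \in [set: E]) P (F e))%E.
  rewrite (bigfs _ (r := index_enum E) (P := xpredT)) ?index_enum_uniq//.
    by rewrite (_ : [set` xpredT] = setT)//; apply/seteqP.
  by move=> i _; rewrite mem_index_enum.
rewrite -measure_fin_bigcup//.
- congr (P _); apply/seteqP; split=> u; last by case=> e _ [].
  by move=> Du; exists (X u).
- exact: finite_finset.
- apply/trivIsetP => e e' _ _ /eqP ee'; apply/seteqP; split=> // u [[_ eu] [_ e'u]].
  by apply: ee'; rewrite -eu -e'u.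
- by move=> e _; exact: measurableI.
Qed.

Lemma fiber_expansion (f : E -> R) u :
  f (X u) = \sum_e f e * \1_[set u | X u = e] u.
Proof.
rewrite (bigD1 (X u))//= big1 ?addr0 => [|e ne]; rewrite indicE.
  by rewrite mem_set// mulr1.
by rewrite memNset ?mulr0// => /= Xu; rewrite Xu eqxx in ne.
Qed.

Lemma measurable_finite_fun (f : E -> R) : measurable_fun setT (f \o X).
Proof.
rewrite (_ : f \o X = fun u => \sum_e f e * \1_[set u | X u = e] u); last first.
  by apply/funext => u; exact: fiber_expansion.
apply: measurable_sum => e; apply: measurable_funM; first exact: measurable_cst.
exact: measurable_indic.
Qed.

Lemma integral_finite_fun (f : E -> R) : (forall e, 0 <= f e) ->
  (\int[P]_u (f (X u))%:E = \sum_e (f e)%:E * P [set u | X u = e])%E.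
Proof.
move=> f0; under eq_integral do rewrite fiber_expansion -sumEFin.
rewrite ge0_integral_sum//.
- apply: eq_bigr => e _; under eq_integral do rewrite EFinM.
  rewrite ge0_integralZl_EFin//.
  + by rewrite integral_indic ?setIT.
  + by apply/measurable_EFinP; exact: measurable_indic.
- move=> e; apply/measurable_EFinP; apply: measurable_funM; first exact: measurable_cst.
  exact: measurable_indic.
- by move=> e u _; rewrite lee_fin mulr_ge0.
Qed.

End fibers.

Lemma sum_triple (V : nmodType) (S A B : finType) (F : S * A * B -> V) :
  \sum_e F e = \sum_s \sum_a \sum_b F (s, a, b).
Proof.
rewrite (pair_bigA _ (fun s a => \sum_b F (s, a, b))).
rewrite (pair_bigA _ (fun sa b => F (sa.1, sa.2, b)))/=.
by apply: eq_bigr => -[[]].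
Qed.

Section state_law.
Context {R : realType} {S A B : finType} (G : markov_game R S A B)
  (x : policy R S A) (y : policy R S B).

(** The transition matrix of the Markov chain of (state, action, action) triples. *)
Definition play_step (e e' : S * A * B) : R :=
  trans G e.1.1 e.1.2 e.2 e'.1.1 * (x e'.1.1 e'.1.2 * y e'.1.1 e'.2).

Lemma play_prob_next s w n : play_prob G x y s w n.+1 =
  play_prob G x y s w n * play_step (w n) (w n.+1).
Proof.
rewrite /play_prob /play_step [in LHS]big_ord_recr [X in _ * _ * X = _]big_ord_recr/=.
ring.
Qed.

Fixpoint state_law (s : S) (t : nat) (s' : S) : R :=
  if t is t'.+1 then
    \sum_s0 \sum_a \sum_b
      state_law s t' s0 * (x s0 a * y s0 b) * trans G s0 a b s'
  else (s == s')%:R.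

Context (s : S) d (W : measurableType d) (P : probability W R)
  (Z : nat -> W -> S * A * B).
Context (playZ : is_play G x y s P Z).

Let mZ t e : measurable [set u | Z t u = e]. Proof. by case: playZ. Qed.

Let window k n (w : nat -> S * A * B) :=
  [set u | forall t, (k <= t <= n)%N -> Z t u = w t].

Let measurable_window k n w : measurable (window k n w).
Proof.
rewrite (_ : window k n w =
  \bigcap_(t in [set t | (k <= t <= n)%N]) [set u | Z t u = w t])//.
by apply: bigcap_measurableType => t _; exact: mZ.
Qed.

(** Summing over the values of the triple at time k keeps the form of the formula, so
the conditioning on the first triples is forgotten one time at a time. *)
Let window_step k n w : (k <= n)%N ->
  P (window k n.+1 w) = (P (window k n w) * (play_step (w n) (w n.+1))%:E)%E.
Proof.
elim: k w => [|k IH] w kn.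
  case: playZ => _ law; have E m : window 0 m w =
      [set u | forall t, (t <= m)%N -> Z t u = w t] by [].
  by rewrite !E !law -EFinM play_prob_next.
pose upd e t := if t == k then e else w t.
have split_window m : (k <= m)%N ->
    P (window k.+1 m w) = (\sum_e P (window k m (upd e)))%E.
  move=> km; rewrite (measure_sum_fiber P (mZ k))//.
  apply: eq_bigr => e _; congr (P _); apply/seteqP; split=> u /=.
    move=> [wu Zk] t /andP[kt tm]; rewrite /upd.
    by case: eqP => [->//|/eqP tk]; rewrite wu// tm andbT ltn_neqAle eq_sym tk.
  move=> wu; split=> [t /andP[kt tm]|].
    by rewrite wu ?(ltnW kt)// /upd gtn_eqF.
  by rewrite wu ?leqnn// /upd eqxx.
rewrite !split_window ?(ltnW kn)//; last by rewrite (leq_trans (ltnW kn)).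
rewrite ge0_sume_distrl//; apply: eq_bigr => e _.
rewrite IH ?(ltnW kn)//; congr (_ * (play_step _ _)%:E)%E.
  by rewrite /upd gtn_eqF.
by rewrite /upd gtn_eqF// ltnW.
Qed.

(** Once the past before time n is forgotten, [window_step] is the Markov property
between the times n and n + 1; summing it over the triple at time n gives the
recursion of [state_law]. *)
Lemma play_marginal t e : P [set u | Z t u = e] =
  (state_law s t e.1.1 * (x e.1.1 e.1.2 * y e.1.1 e.2))%:E.
Proof.
elim: t e => [|n IH] e.
  have [_ /(_ (fun=> e) 0%N)] := playZ.
  rewrite /play_prob big_ord_recl !big_ord0 !mulr1/= (eq_sym s) => <-.
  by congr (P _); apply/seteqP; split => u /= ue; [case|apply: ue].
rewrite (measure_sum_fiber P (mZ n))//=.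
rewrite -[X in _ = (X * _)%:E](sum_triple (fun e0 => state_law s n e0.1.1 *
  (x e0.1.1 e0.1.2 * y e0.1.1 e0.2) * trans G e0.1.1 e0.1.2 e0.2 e.1.1)).
rewrite mulr_suml -sumEFin; apply: eq_bigr => e0 _.
pose w t := if t == n then e0 else e.
have -> : [set u | Z n.+1 u = e] `&` [set u | Z n u = e0] = window n n.+1 w.
  apply/seteqP; split=> u /=.
    move=> [Ze Ze0] t /andP[]; rewrite leq_eqVlt => /predU1P[<- _|nt tn].
      by rewrite /w eqxx.
    by rewrite /w gtn_eqF// (_ : t = n.+1)//; apply/eqP; rewrite eqn_leq tn.
  move=> wu; rewrite !wu ?leqnn ?leqnSn//; split; first by rewrite /w gtn_eqF.
  by rewrite /w eqxx.
rewrite window_step// (_ : window n n w = [set u | Z n u = e0]).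
  by rewrite IH -EFinM /w eqxx gtn_eqF// /play_step; congr (_%:E); ring.
apply/seteqP; split=> u /= => [wu|Ze t].
  by rewrite wu ?leqnn// /w eqxx.
by rewrite -eqn_leq => /eqP <-; rewrite /w eqxx.
Qed.

End state_law.

(** * Discounted sums and the performance difference identity *)

Section discounted.
Context {R : realType} {S A B : finType} (G : markov_game R S A B)
  (x : policy R S A) (y : policy R S B).

Let th := discount G.
Let th_ge0 : 0 <= th. Proof. by have /andP[] := discount_itv G. Qed.
Let th_lt1 : th < 1. Proof. by have /andP[] := discount_itv G. Qed.

Definition cost_tensor : tensor R S A B := fun e => cost G e.1.1 e.1.2 e.2.

Definition next_tensor (v : S -> R) : tensor R S A B :=
  fun e => \sum_s trans G e.1.1 e.1.2 e.2 s * v s.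

Definition lookahead (v : S -> R) : tensor R S A B :=
  fun e => (1 - th) * cost_tensor e + th * next_tensor v e.

Definition law_mean s t (v : S -> R) : R := \sum_s' state_law G x y s t s' * v s'.

Definition policy_mean (Q : tensor R S A B) : S -> R := fun s => bilin Q s (x s) (y s).

Lemma state_law_ge0 s t s' : 0 <= state_law G x y s t s'.
Proof.
elim: t s' => [|t IH] s' /=; first exact: ler0n.
do 3 (apply: sumr_ge0 => ? _).
by apply: mulr_ge0; [apply: mulr_ge0 => //; apply: mulr_ge0|]; exact: Defs.pmf_ge0.
Qed.

Lemma law_mean0 s v : law_mean s 0 v = v s.
Proof.
rewrite /law_mean (bigD1 s)//= eqxx mul1r big1 ?addr0// => s' /negbTE.
by rewrite eq_sym => ->; rewrite mul0r.
Qed.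

(** Chapman-Kolmogorov, in the form used for telescoping: the mean of [v] after one
more step is the current mean of the expected next value. *)
Lemma law_meanS s t v : law_mean s t.+1 v = law_mean s t (policy_mean (next_tensor v)).
Proof.
rewrite /law_mean /=; under eq_bigr do rewrite mulr_suml.
rewrite exchange_big; apply: eq_bigr => s0 _.
under eq_bigr do rewrite mulr_suml.
rewrite exchange_big /policy_mean /bilin mulr_sumr; apply: eq_bigr => a _.
under eq_bigr do rewrite mulr_suml.
rewrite exchange_big mulr_sumr; apply: eq_bigr => b _.
rewrite /next_tensor/= -!mulrA mulr_suml !mulr_sumr; apply: eq_bigr => s' _; ring.
Qed.

Lemma policy_mean_cst c : policy_mean (fun=> c) = fun=> c.
Proof.
by apply/funext => s; apply/le_anti; rewrite bilin_le//= bilin_ge.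
Qed.

Lemma next_tensor_cst c : next_tensor (fun=> c) = fun=> c.
Proof. by apply/funext => e; rewrite /next_tensor -mulr_suml pmf_sum1 mul1r. Qed.

Lemma law_mean_cst s t c : law_mean s t (fun=> c) = c.
Proof.
by elim: t => [|t IH]; rewrite ?law_mean0// law_meanS next_tensor_cst policy_mean_cst.
Qed.

Lemma ler_law_mean s t v v' : (forall s', v s' <= v' s') ->
  law_mean s t v <= law_mean s t v'.
Proof. by move=> vv'; apply: ler_sum => s' _; rewrite ler_wpM2l ?state_law_ge0. Qed.

Lemma law_meanD s t v v' :
  law_mean s t (fun s' => v s' + v' s') = law_mean s t v + law_mean s t v'.
Proof. by rewrite /law_mean -big_split; apply: eq_bigr => s' _; rewrite mulrDr. Qed.

Lemma law_meanZ s t c v : law_mean s t (fun s' => c * v s') = c * law_mean s t v.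
Proof. by rewrite /law_mean mulr_sumr; apply: eq_bigr => s' _; rewrite mulrCA. Qed.

Lemma policy_mean_lookahead v s : policy_mean (lookahead v) s =
  (1 - th) * policy_mean cost_tensor s + th * policy_mean (next_tensor v) s.
Proof.
rewrite /policy_mean /bilin !mulr_sumr -big_split; apply: eq_bigr => a _ /=.
rewrite !mulr_sumr -big_split; apply: eq_bigr => b _ /=; rewrite /lookahead; ring.
Qed.

(** With E_t the mean over the state at time t, the sum telescopes because
E_t (lookahead v) - E_t v = (1 - theta) E_t cost + theta E_{t+1} v - E_t v. *)
Lemma performance_difference v s n :
  (1 - th) * series (fun t => th ^+ t * law_mean s t (policy_mean cost_tensor)) n =
  v s - th ^+ n * law_mean s n v +
  series (fun t => th ^+ t * law_mean s t (fun s' => policy_mean (lookahead v) s' - v s')) n.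
Proof.
elim: n => [|n IH]; first by rewrite /series/= !big_geq// law_mean0; ring.
rewrite !seriesSr mulrDr IH law_meanS.
have -> : (fun s' => policy_mean (lookahead v) s' - v s') =
  (fun s' => ((1 - th) * policy_mean cost_tensor s'
              + th * policy_mean (next_tensor v) s') + -1 * v s').
  by apply/funext => s'; rewrite policy_mean_lookahead mulN1r.
rewrite !law_meanD !law_meanZ exprS; ring.
Qed.

(** The discount factors before time n sum to (1 - theta^n) / (1 - theta). *)
Lemma discounted_series_le (a : nat -> R) D n : (forall t, a t <= D) ->
  (1 - th) * series (fun t => th ^+ t * a t) n <= (1 - th ^+ n) * D.
Proof.
move=> aD; elim: n => [|n IH]; first by rewrite /series/= big_geq// mulr0 expr0 subrr mul0r.
rewrite seriesSr mulrDr.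
have -> : (1 - th ^+ n.+1) * D = (1 - th ^+ n) * D + (1 - th) * (th ^+ n * D).
  by rewrite exprS; ring.
apply: lerD => //; rewrite ler_wpM2l ?subr_ge0 ?(ltW th_lt1)// ler_wpM2l//.
exact: exprn_ge0.
Qed.

Lemma policy_mean_cost_itv s : 0 <= policy_mean cost_tensor s <= 1.
Proof.
by apply/andP; split; [apply: bilin_ge|apply: bilin_le] => a b;
  have /andP[] := cost_itv G s a b.
Qed.

Lemma mean_cost_itv s t : 0 <= law_mean s t (policy_mean cost_tensor) <= 1.
Proof.
rewrite -{1}(law_mean_cst s t 0) -(law_mean_cst s t 1) !ler_law_mean// => s';
  by have /andP[] := policy_mean_cost_itv s'.
Qed.

Lemma cvg_cost_series (a : nat -> R) : (forall t, 0 <= a t <= 1) ->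
  cvgn (series (fun t => th ^+ t * a t)).
Proof.
move=> a01; apply: (@series_le_cvg _ _ (geometric 1 th)) => [n|n|n|].
- by rewrite mulr_ge0 ?exprn_ge0//; have /andP[] := a01 n.
- by rewrite /geometric/= mul1r exprn_ge0.
- by rewrite /geometric/= mul1r ler_piMr ?exprn_ge0//; have /andP[] := a01 n.
- by apply: is_cvg_geometric_series; rewrite ger0_norm.
Qed.

(** The costs are nonnegative, so that the expectation and the series exchange; the
law of each term is given by [play_marginal]. *)
Lemma value_series s : value G x y s =
  (1 - th) * limn (series (fun t => th ^+ t * law_mean s t (policy_mean cost_tensor))).
Proof.
rewrite /value; congr (_ * _); rewrite unlock.
have playZ := playP G x y s; set Z := play G x y s in playZ *.
set P := uniform_prob _ in playZ *.
have mZ := playZ.1.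
have eq_nneseries (a : nat -> R) : (forall t, 0 <= a t <= 1) ->
    (limn (series (fun t => th ^+ t * a t)))%:E =
    (\sum_(0 <= t <oo) (th ^+ t * a t)%:E)%E.
  move=> /cvg_cost_series ca; rewrite -EFin_lim//; congr (limn _).
  by apply/funext => n; rewrite /= sumEFin.
pose f t (e : S * A * B) := th ^+ t * cost_tensor e.
have f_ge0 t e : 0 <= f t e.
  by rewrite mulr_ge0 ?exprn_ge0//; have /andP[] := cost_itv G e.1.1 e.1.2 e.2.
have seriesE u : (limn (series (fun t => let: (st, a, b) := Z t u in
    discount G ^+ t * cost G st a b)))%:E = (\sum_(0 <= t <oo) (f t (Z t u))%:E)%E.
  rewrite -(eq_nneseries (fun t => cost_tensor (Z t u))); last first.
    by move=> t; exact: cost_itv.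
  congr (limn (series _))%:E; apply/funext => t.
  by case: (Z t u) => -[].
under eq_integral => u _ do rewrite seriesE.
rewrite (integral_nneseries P _ (f := fun t u => (f t (Z t u))%:E))//; last first.
- by move=> t u _; rewrite lee_fin.
- by move=> t; apply/measurable_EFinP; exact: (measurable_finite_fun (mZ t) (f t)).
rewrite -[RHS]/(fine (limn (series _))%:E) eq_nneseries; last exact: mean_cost_itv.
congr fine; apply: eq_eseriesr => t _.
rewrite (integral_finite_fun P (mZ t) (f_ge0 t)).
under eq_bigr do rewrite (play_marginal playZ) -EFinM.
rewrite sumEFin sum_triple /law_mean mulr_sumr; congr (_%:E).
apply: eq_bigr => s' _; rewrite /policy_mean /bilin !mulr_sumr; apply: eq_bigr => a _.
rewrite !mulr_sumr; apply: eq_bigr => b _; rewrite /f /=; ring.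
Qed.

(** [v] is bounded, as there are finitely many states. *)
Lemma law_mean_vanish s v : th ^+ n * law_mean s n v @[n --> \oo] --> 0.
Proof.
pose M := \sum_s' `|v s'|.
have v_le s' : `|v s'| <= M by rewrite /M (bigD1 s')//= lerDl sumr_ge0.
have cvgM0 c : th ^+ n * c @[n --> \oo] --> 0.
  rewrite -(mul0r c); apply: cvgM; last exact: cvg_cst.
  by apply: cvg_expr; rewrite ger0_norm.
apply: (squeeze_cvgr _ (cvgM0 (- M)) (cvgM0 M)).
apply: nearW => n; rewrite !ler_wpM2l ?exprn_ge0//=.
  by rewrite -(law_mean_cst s n M) ler_law_mean// => s'; rewrite (le_trans (ler_norm _)).
rewrite -(law_mean_cst s n (- M)) ler_law_mean// => s'.
by have := v_le s'; rewrite ler_norml => /andP[].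
Qed.

Lemma cvg_performance_difference v s :
  series (fun t => th ^+ t * law_mean s t (fun s' => policy_mean (lookahead v) s' - v s'))
    @ \oo --> value G x y s - v s.
Proof.
have -> : series (fun t => th ^+ t * law_mean s t
      (fun s' => policy_mean (lookahead v) s' - v s')) =
    (fun n => (1 - th) * series (fun t => th ^+ t * law_mean s t (policy_mean cost_tensor)) n
      - v s + th ^+ n * law_mean s n v).
  by apply/funext => n; rewrite (performance_difference v); ring.
rewrite value_series -[X in _ --> X]addr0; apply: cvgD; last exact: law_mean_vanish.
apply: cvgB; last exact: cvg_cst.
apply: cvgM; first exact: cvg_cst.
by apply: cvg_cost_series => t; exact: mean_cost_itv.
Qed.

Lemma value_le v D s : 0 <= D ->
  (forall s', policy_mean (lookahead v) s' - v s' <= D) ->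
  value G x y s <= v s + D / (1 - th).
Proof.
move=> D_ge0 advD; have th1 : 0 < 1 - th by rewrite subr_gt0.
rewrite -lerBlDl; apply: (cvgr_to_le (@cvg_performance_difference v s)).
apply: nearW => n; rewrite ler_pdivlMr// mulrC.
apply: le_trans (@discounted_series_le _ D n _) _ => [t|].
  by rewrite -[leRHS](law_mean_cst s t D) ler_law_mean.
by rewrite ler_piMl// lerBlDl lerDr exprn_ge0.
Qed.

Lemma series_oppr (a : nat -> R) n :
  series (fun t => th ^+ t * (- a t)) n = - series (fun t => th ^+ t * a t) n.
Proof. by rewrite /series/= -sumrN; apply: eq_bigr => t _; rewrite mulrN. Qed.

Lemma value_ge v D s : 0 <= D ->
  (forall s', v s' - policy_mean (lookahead v) s' <= D) ->
  v s - D / (1 - th) <= value G x y s.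
Proof.
move=> D_ge0 advD; have th1 : 0 < 1 - th by rewrite subr_gt0.
rewrite addrC -lerBrDr; apply: (cvgr_to_ge (@cvg_performance_difference v s)).
apply: nearW => n; rewrite lerNl -series_oppr ler_pdivlMr// mulrC.
apply: le_trans (@discounted_series_le _ D n _) _ => [t|].
  rewrite -mulN1r -law_meanZ -[leRHS](law_mean_cst s t D) ler_law_mean// => s'.
  by rewrite mulN1r opprB.
by rewrite ler_piMl// lerBlDl lerDr exprn_ge0.
Qed.

End discounted.

(** * Shapley's equation *)

Section shapley.
Context {R : realType} {S A B : finType} (G : markov_game R S A B).
Context (A_gt0 : (0 < #|A|)%N) (B_gt0 : (0 < #|B|)%N).

Let th := discount G.
Let th_ge0 : 0 <= th. Proof. by have /andP[] := discount_itv G. Qed.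
Let th_le1 : 0 <= 1 - th.
Proof. by rewrite subr_ge0 ltW//; have /andP[] := discount_itv G. Qed.

Lemma ler_lookahead v v' e : (forall s, v s <= v' s) ->
  lookahead G v e <= lookahead G v' e.
Proof.
move=> vv'; rewrite lerD2l ler_wpM2l//.
by apply: ler_sum => s _; rewrite ler_wpM2l ?Defs.pmf_ge0.
Qed.

Lemma lookahead_le1 v e : (forall s, v s <= 1) -> lookahead G v e <= 1.
Proof.
move=> v1; rewrite /lookahead -[leRHS](subrK th) lerD//.
  by rewrite ler_piMr//; have /andP[] := cost_itv G e.1.1 e.1.2 e.2.
by rewrite ler_piMr//; exact: expect_le.
Qed.

Lemma lookahead_ge0 v e : (forall s, 0 <= v s) -> 0 <= lookahead G v e.
Proof.
move=> v0; rewrite /lookahead addr_ge0// mulr_ge0//.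
  by have /andP[] := cost_itv G e.1.1 e.1.2 e.2.
exact: expect_ge.
Qed.

(** Let T send v to the values of the matrix games [lookahead v].  The supremum v of
the u <= 1 with u <= T u satisfies v <= T v, since T is monotone; then T v is itself
such a u, so T v <= v. *)
Theorem shapley_equation : exists v z, forall s : S,
  saddle (lookahead G v) s (z s) /\ v s = bilin (lookahead G v) s (z s).1 (z s).2.
Proof.
pose z v s := sval (cid (saddle_exists A_gt0 B_gt0 (lookahead G v) s)).
have zP v s : saddle (lookahead G v) s (z v s) by exact: svalP.
pose T v s := bilin (lookahead G v) s (z v s).1 (z v s).2.
have T_mono v v' : (forall s, v s <= v' s) -> forall s, T v s <= T v' s.
  move=> vv' s; apply: saddle_value_le (zP v s) (zP v' s) _ => a b.
  exact: ler_lookahead.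
pose D := [set v : S -> R | forall s, v s <= T v s /\ v s <= 1].
have D0 : D (fun=> 0).
  by move=> s; split=> //; apply: bilin_ge => a b; exact: lookahead_ge0.
pose v s := sup [set u s | u in D].
have v_ub u s : D u -> u s <= v s.
  move=> Du; apply: ub_le_sup; last by exists u.
  by exists 1 => _ [u' /(_ s)[_ u'1] <-].
have v_lub s c : (forall u, D u -> u s <= c) -> v s <= c.
  move=> uc; apply: ge_sup; first by exists 0, (fun=> 0).
  by move=> _ [u Du <-]; exact: uc.
have v_le1 s : v s <= 1 by apply: v_lub => u /(_ s)[].
have v_leT s : v s <= T v s.
  apply: v_lub => u Du; apply: le_trans (Du s).1 _.
  by apply: T_mono => s'; exact: v_ub.
exists v, (z v) => s; split; first exact: zP.
apply/le_anti; rewrite v_leT/=; apply: (v_ub (T v)) => s'; split.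
  exact: T_mono.
by apply: bilin_le => a b; exact: lookahead_le1.
Qed.

End shapley.

(** * Lipschitz bounds and gaps *)

Section sup_norm.
Context {R : realType}.

Lemma le_sup_norm (I : finType) (v : I -> R) i : `|v i| <= sup_norm v.
Proof. exact: le_bigmax. Qed.

Lemma sup_norm_le (I : finType) (v : I -> R) c :
  0 <= c -> (forall i, `|v i| <= c) -> sup_norm v <= c.
Proof. by move=> c0 vc; apply: bigmax_le. Qed.

Lemma sup_norm_ge0 (I : finType) (v : I -> R) : 0 <= sup_norm v.
Proof. exact: bigmax_ge_id. Qed.

Lemma norm_expect_le (T : finType) (p : simplex R T) (f : T -> R) c :
  (forall t, `|f t| <= c) -> `|\sum_t p t * f t| <= c.
Proof.
move=> fc; rewrite ler_norml expect_le ?expect_ge// => t;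
  by have := fc t; rewrite ler_norml => /andP[].
Qed.

Lemma norm_sum_mul_le (T : finType) (f g : T -> R) :
  (forall t, `|f t| <= 1) -> `|\sum_t f t * g t| <= \sum_t `|g t|.
Proof.
move=> f1; apply: le_trans (ler_norm_sum _ _ _) _.
by apply: ler_sum => t _; rewrite normrM ler_piMl.
Qed.

End sup_norm.

Section operators.
Context {R : realType} {S A B : finType}.
Implicit Types (Q : tensor R S A B) (i : S) (xi : simplex R A) (yi : simplex R B).

Lemma norm_bilin_le Q i xi yi c :
  (forall a b, `|Q (i, a, b)| <= c) -> `|bilin Q i xi yi| <= c.
Proof.
by move=> Qc; rewrite bilin_exp_col; do 2 (apply: norm_expect_le => ?).
Qed.

Lemma bilinB Q Q' i xi yi :
  bilin Q i xi yi - bilin Q' i xi yi = bilin (Q \- Q') i xi yi.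
Proof.
rewrite /bilin -sumrB; apply: eq_bigr => a _; rewrite -sumrB.
by apply: eq_bigr => b _ /=; ring.
Qed.

Lemma bilin_Fx Q i xi yi : bilin Q i xi yi = \sum_a Fx Q i yi a * xi a.
Proof.
rewrite bilin_exp_row; apply: eq_bigr => a _; rewrite mulrC; congr (_ * _).
by apply: eq_bigr => b _; rewrite mulrC.
Qed.

Lemma bilin_Fy Q i xi yi : bilin Q i xi yi = - \sum_b Fy Q i xi b * yi b.
Proof.
rewrite bilin_exp_col -sumrN; apply: eq_bigr => b _.
rewrite /Fy mulNr opprK mulrC; congr (_ * _).
by apply: eq_bigr => a _; rewrite mulrC.
Qed.

Lemma F_dist_tensor Q Q' i xi yi : F_dist i Q xi yi Q' xi yi <= sup_norm (Q \- Q').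
Proof.
rewrite /F_dist ge_max; apply/andP; split; apply: sup_norm_le;
  rewrite ?sup_norm_ge0// => c.
- rewrite /= /Fx -sumrB; under eq_bigr do rewrite -mulrBl mulrC.
  by apply: norm_expect_le => b; exact: (le_sup_norm (Q \- Q')).
- rewrite /= /Fy -opprD normrN -sumrB; under eq_bigr do rewrite -mulrBl mulrC.
  by apply: norm_expect_le => a; exact: (le_sup_norm (Q \- Q')).
Qed.

Lemma F_dist_point Q i xi xi' yi yi' : sup_norm Q <= 1 ->
  F_dist i Q xi yi Q xi' yi' <= l1_norm (xi \- xi') + l1_norm (yi \- yi').
Proof.
move=> Q1; have Qe e : `|Q e| <= 1 by exact: le_trans (le_sup_norm Q e) Q1.
have l1_ge0 (T : finType) (f : T -> R) : 0 <= l1_norm f by exact: sumr_ge0.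
rewrite /F_dist ge_max; apply/andP; split; apply: sup_norm_le;
  rewrite ?addr_ge0// => c.
- rewrite /= /Fx -sumrB; under eq_bigr do rewrite -mulrBr.
  apply: le_trans (norm_sum_mul_le _ _) _ => //; exact: ler_wpDl.
- rewrite /= /Fy -opprD normrN -sumrB; under eq_bigr do rewrite -mulrBr.
  apply: le_trans (norm_sum_mul_le _ _) _ => //; exact: ler_wpDr.
Qed.

Context (G : markov_game R S A B).
Let th := discount G.
Let th_ge0 : 0 <= th. Proof. by have /andP[] := discount_itv G. Qed.
Let th_lt1 : th < 1. Proof. by have /andP[] := discount_itv G. Qed.

(** The weights theta * trans found here are the constant tensors that bound the
variation of P in each player's policy. *)
Lemma lookaheadB v v' e : lookahead G v e - lookahead G v' e =
  \sum_s th * trans G e.1.1 e.1.2 e.2 s * (v s - v' s).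
Proof.
rewrite /lookahead opprD addrACA subrr add0r -mulrBr -sumrB mulr_sumr.
by apply: eq_bigr => s _; rewrite /th; ring.
Qed.

Lemma norm_lookaheadB v v' c e : (forall s, `|v s - v' s| <= c) ->
  `|lookahead G v e - lookahead G v' e| <= th * c.
Proof.
move=> vc; rewrite lookaheadB; under eq_bigr do rewrite -mulrA.
by rewrite -mulr_sumr normrM ger0_norm// ler_wpM2l// norm_expect_le.
Qed.

Lemma norm_lookahead_le1 v e : (forall s, `|v s| <= 1) -> `|lookahead G v e| <= 1.
Proof.
move=> v1; rewrite /lookahead; apply: le_trans (ler_normD _ _) _.
rewrite -[leRHS](subrK th) lerD// normrM ger0_norm ?subr_ge0 ?(ltW th_lt1)//.
- rewrite ler_piMr ?subr_ge0 ?(ltW th_lt1)//.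
  have /andP[c0 c1] := cost_itv G e.1.1 e.1.2 e.2.
  by rewrite /cost_tensor ger0_norm.
- by rewrite ler_piMr//; exact: norm_expect_le.
Qed.

(** Let M i and m i be the payoffs of the matrix game at i when x i, respectively
y i, meets a best reply.  Then (x, y') gains at most M i - v i on v in one step at
i, whatever y', and (x', y) loses at most v i - m i, whatever x'.  Both bounds are
nonnegative, since the optimal strategies are among the replies; so their sums
over the states bound them at every state, as [value_le] and [value_ge] require. *)
Lemma gap_value_le (v : S -> R) (z : S -> simplex R A * simplex R B) :
  (forall s, saddle (lookahead G v) s (z s) /\
             v s = bilin (lookahead G v) s (z s).1 (z s).2) ->
  forall (rho : simplex R S) x y,
  gap (fun x y => expected_value G x y rho) x y <=
    \sum_i (1 - th)^-1 * gap (bilin (lookahead G v) i) (x i) (y i).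
Proof.
move=> vz rho x y; set Q := lookahead G v.
have Qle e : `|Q e| <= sup_norm Q by exact: le_sup_norm.
have bilin_norm i xi yi : `|bilin Q i xi yi| <= sup_norm Q by exact: norm_bilin_le.
pose M i := sup [set bilin Q i (x i) yi | yi in setT].
pose m i := inf [set bilin Q i xi (y i) | xi in setT].
have le_M i yi : bilin Q i (x i) yi <= M i.
  apply: ub_le_sup; last by exists yi.
  by exists (sup_norm Q) => _ [yi' _ <-]; exact: le_trans (ler_norm _) (bilin_norm _ _ _).
have m_le i xi : m i <= bilin Q i xi (y i).
  apply: ge_inf; last by exists xi.
  exists (- sup_norm Q) => _ [xi' _ <-].
  by have := bilin_norm i xi' (y i); rewrite ler_norml => /andP[].
have v_M i : v i <= M i.
  by have [[zmin _] ->] := vz i; exact: le_trans (zmin (x i)) (le_M _ _).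
have m_v i : m i <= v i.
  by have [[_ zmax] ->] := vz i; exact: le_trans (m_le _ _) (zmax (y i)).
have le_sum (f : S -> R) i : (forall j, 0 <= f j) -> f i <= \sum_j f j.
  by move=> f0; rewrite (bigD1 i)//= lerDl sumr_ge0.
pose D1 := \sum_i (M i - v i); pose D2 := \sum_i (v i - m i).
have D1_ge0 : 0 <= D1 by apply: sumr_ge0 => i _; rewrite subr_ge0.
have D2_ge0 : 0 <= D2 by apply: sumr_ge0 => i _; rewrite subr_ge0.
pose J := \sum_s rho s * v s.
have upper : sup [set expected_value G x y' rho | y' in setT] <= J + D1 / (1 - th).
  apply: ge_sup; first by exists (expected_value G x y rho), y.
  move=> _ [y' _ <-]; rewrite -lerBlDl /J -sumrB.
  under eq_bigr do rewrite -mulrBr.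
  apply: expect_le => s; rewrite lerBlDl; apply: value_le => // s'.
  apply: le_trans (le_sum (fun i => M i - v i) s' _) => [|j]; last by rewrite subr_ge0.
  by rewrite lerB// le_M.
have lower : J - D2 / (1 - th) <= inf [set expected_value G x' y rho | x' in setT].
  apply: lb_le_inf; first by exists (expected_value G x y rho), x.
  move=> _ [x' _ <-]; rewrite lerBlDr -lerBlDl /J -sumrB.
  under eq_bigr do rewrite -mulrBr.
  apply: expect_le => s; rewrite lerBlDl -lerBlDr; apply: value_ge => // s'.
  apply: le_trans (le_sum (fun i => v i - m i) s' _) => [|j]; last by rewrite subr_ge0.
  by rewrite lerB// m_le.
apply: le_trans (lerB upper lower) _.
have -> : J + D1 / (1 - th) - (J - D2 / (1 - th)) = (D1 + D2) * (1 - th)^-1 by ring.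
rewrite /D1 /D2 -big_split mulr_suml le_eqVlt; apply/orP; left; apply/eqP.
by apply: eq_bigr => i _; rewrite /= addrA subrK mulrC.
Qed.

End operators.

(** * The operator P *)

Theorem proposition4p5 (R : realType) (S A B : finType)
    (A_gt0 : (0 < #|A|)%N) (B_gt0 : (0 < #|B|)%N) (G : markov_game R S A B) :
  exists (P : tensor R S A B -> policy R S A -> policy R S B -> tensor R S A B)
         (Qs : tensor R S A B) (xs : policy R S A) (ys : policy R S B),
    (* (i) *)
    (Qs = P Qs xs ys /\
     (forall (x : policy R S A) e, Qs e <= P Qs x ys e) /\
     (forall (y : policy R S B) e, P Qs xs y e <= Qs e)) /\
    (* (ii) *)
    (forall rho0 : simplex R S,
       quasar_convex_concave (fun x y => expected_value G x y rho0) (bilin Qs)) /\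
    (* (iii) *)
    (exists C : R, 0 < C /\
      (* A1 *)
      (exists L1 L2 : R, 0 <= L1 /\ 0 <= L2 /\
        (forall (Q Q' : tensor R S A B) (i : S)
                (xi : simplex R A) (yi : simplex R B),
           sup_norm Q <= C -> sup_norm Q' <= C ->
           F_dist i Q xi yi Q' xi yi <= L1 * sup_norm (Q \- Q')) /\
        (forall (Q : tensor R S A B) (i : S)
                (xi xi' : simplex R A) (yi yi' : simplex R B),
           sup_norm Q <= C ->
           F_dist i Q xi yi Q xi' yi' <=
             L2 * (l1_norm (xi \- xi') + l1_norm (yi \- yi')))) /\
      (* A2 *)
      (exists (gamma : R) (Bt Ct : S -> tensor R S A B), 0 < gamma /\
        (forall i e, 0 <= Bt i e) /\ (forall i e, 0 <= Ct i e) /\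
        sup_norm (fun e => \sum_i (Bt i e + Ct i e)) <= gamma /\
        (forall (Q : tensor R S A B) (x x' : policy R S A) (y y' : policy R S B),
           sup_norm Q <= C ->
           (forall e, P Q x y e - P Q x' y e <=
              \sum_i Ct i e * \sum_a Fx Q i (y i) a * (x i a - x' i a)) /\
           (forall e, \sum_i Bt i e * (\sum_b Fy Q i (x i) b * (y' i b - y i b))
              <= P Q x y e - P Q x y' e))) /\
      (* A3 *)
      (exists theta' : R, 0 <= theta' < 1 /\
        (forall (Q Q' : tensor R S A B) (x : policy R S A) (y : policy R S B),
           sup_norm Q <= C -> sup_norm Q' <= C ->
           sup_norm (P Q x y \- P Q' x y) <= theta' * sup_norm (Q \- Q'))) /\
      (forall (Q : tensor R S A B) (x : policy R S A) (y : policy R S B),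
         sup_norm Q <= C -> sup_norm (P Q x y) <= C)).
Proof.
have [v [z vz]] := shapley_equation G A_gt0 B_gt0.
have /andP[th_ge0 th_lt1] := discount_itv G.
pose Qs := lookahead G v; pose xs s := (z s).1; pose ys s := (z s).2.
have vE : v = policy_mean xs ys Qs by apply/funext => s; exact: (vz s).2.
exists (fun Q x y => lookahead G (policy_mean x y Q)), Qs, xs, ys.
split; first split; [by rewrite -vE|split=> [x|y] e|].
- by apply: ler_lookahead => s; rewrite (vz s).2; exact: (vz s).1.1.
- by apply: ler_lookahead => s; rewrite (vz s).2; exact: (vz s).1.2.
split=> [rho|].
  exists (fun _ _ _ => (1 - discount G)^-1); split=> [_ _ _|x y].
    by rewrite invr_ge0 subr_ge0 ltW.
  exact: gap_value_le.
(* 1 also bounds the entries of Q in the Lipschitz bound of F in the strategies. *)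
exists 1; split; first exact: ltr01.
split; [exists 1, 1; split; [|split; [|split]] => //|split; last split].
- by move=> Q Q' i xi yi _ _; rewrite mul1r; exact: F_dist_tensor.
- by move=> Q i xi xi' yi yi' Q1; rewrite mul1r; exact: F_dist_point.
- pose T i (e : S * A * B) := discount G * trans G e.1.1 e.1.2 e.2 i.
  have T_ge0 i e : 0 <= T i e by rewrite mulr_ge0 ?Defs.pmf_ge0.
  exists 2, T, T; do 3 (split=> //); split.
    apply: sup_norm_le => // e.
    rewrite ger0_norm; last by apply: sumr_ge0 => i _; rewrite addr_ge0.
    rewrite big_split/= -mulr_sumr Defs.pmf_sum1 mulr1; lra.
  move=> Q x x' y y' _; split=> e; rewrite lookaheadB le_eqVlt; apply/orP; left; apply/eqP;
    apply: eq_bigr => i _; congr (_ * _); rewrite /policy_mean.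
    by rewrite !bilin_Fx -sumrB; apply: eq_bigr => a _; rewrite mulrBr.
  by rewrite !bilin_Fy opprK addrC -sumrB; apply: eq_bigr => b _; rewrite mulrBr.
- exists (discount G); split; first exact/andP.
  move=> Q Q' x y _ _; apply: sup_norm_le => [|e]; first by rewrite mulr_ge0 ?sup_norm_ge0.
  apply: norm_lookaheadB => s; rewrite /policy_mean bilinB.
  by apply: norm_bilin_le => a b; exact: le_sup_norm.
- move=> Q x y Q1; apply: sup_norm_le => // e; apply: norm_lookahead_le1 => s.
  by apply: norm_bilin_le => a b; exact: le_trans (le_sup_norm Q _) Q1.
Qed.
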